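(* Let $(\mathcal X_+,\mathcal X_0,\mathcal X_-)$ be a quasi Gelfand triple of Hilbert spaces. Then the set $D_+\cap D_-$ is dense in $\mathcal X_+$ and in $\mathcal X_-$ with respect to their corresponding norms. More precisely, $\operatorname{dom}\iota_+^*\iota_+=\iota_+^{-1}(D_+\cap D_-)$ is dense in $\mathcal X_+$ and $\operatorname{dom}\iota_-^*\iota_-=\iota_-^{-1}(D_+\cap D_-)$ is dense in $\mathcal X_-$. Furthermore, $\iota_+^{-1}(D_+\cap D_-)$ is a core of $\iota_+$ and $\iota_-^{-1}(D_+\cap D_-)$ is a core of $\iota_-$.
   Context: All spaces are complex; the anti-dual $X'$ of a Banach space $X$ is the space of continuous antilinear functionals on $X$. For Banach spaces $X,Y$ and a continuous sesquilinear form $\langle\cdot,\cdot\rangle_{Y,X}:Y\times X\to\mathbb C$ (linear in the first, antilinear in the second argument), put $\langle x,y\rangle_{X,Y}:=\overline{\langle y,x\rangle_{Y,X}}$. $(X,Y)$ is a complete dual pair if $Y\to X'$, $y\mapsto\langle y,\cdot\rangle_{Y,X}$ and $X\to Y'$, $x\mapsto\langle x,\cdot\rangle_{X,Y}$ are both isometric and bijective. A pre-quasi Gelfand triple $(\mathcal X_+,\mathcal X_0,\mathcal X_-)$ consists of a complete dual pair $(\mathcal X_+,\mathcal X_-)$, a Hilbert space $\mathcal X_0$ and linear maps $\iota_\pm:\operatorname{dom}\iota_\pm\subseteq\mathcal X_\pm\to\mathcal X_0$ that are densely defined, closed, injective and have dense range, with $\langle g,f\rangle_{\mathcal X_-,\mathcal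 X_+}=\langle\iota_-g,\iota_+f\rangle_{\mathcal X_0}$ for all $f\in\operatorname{dom}\iota_+$, $g\in\operatorname{dom}\iota_-$. Adjoints are taken with respect to the dual pairs $(\mathcal X_0,\mathcal X_0)$ and $(\mathcal X_+,\mathcal X_-)$: $\iota_+^*:\operatorname{dom}\iota_+^*\subseteq\mathcal X_0\to\mathcal X_-$ is defined by $h\in\operatorname{dom}\iota_+^*$, $\iota_+^*h=g$ iff $\langle h,\iota_+f\rangle_{\mathcal X_0}=\langle g,f\rangle_{\mathcal X_-,\mathcal X_+}$ for all $f\in\operatorname{dom}\iota_+$; analogously $\iota_-^*:\operatorname{dom}\iota_-^*\subseteq\mathcal X_0\to\mathcal X_+$ via $\langle h,\iota_-g\rangle_{\mathcal X_0}=\langle f,g\rangle_{\mathcal X_+,\mathcal X_-}$. The triple is a quasi Gelfand triple if in addition $\operatorname{dom}\iota_+^*=\operatorname{ran}\iota_-$; it is ``of Hilbert spaces'' if $\mathcal X_+$ and $\mathcal X_-$ are Hilbert spaces. $D_\pm:=\operatorname{ran}\iota_\pm$, identified with $\operatorname{dom}\iota_\pm\subseteq\mathcal X_\pm$ via $\iota_\pm$. A core of a closed operator $T$ is a subspace of $\operatorname{dom}T$ that is dense in $\operatorname{dom}T$ with respect to the graph norm. *)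

(* Defs.v *)
From HB Require Import structures.
From mathcomp Require Import all_boot all_order all_algebra.
From mathcomp Require Import sesquilinear complex.
From mathcomp Require Import all_classical all_reals all_analysis.

Set Implicit Arguments.
Unset Strict Implicit.
Unset Printing Implicit Defensive.

Import Order.TTheory GRing.Theory Num.Theory.
Import numFieldNormedType.Exports.

Local Open Scope classical_set_scope.
Local Open Scope ring_scope.
Local Open Scope complex_scope.

(* Norms of normed modules over R[i] take their values in R[i]; they are real
   and nonnegative there. *)

HB.mixin Record CompleteNormedModule_isHilbert (R : realType) H
    of CompleteNormedModule R[i] H := {
  inner : {dot H for Num.conj} ;
  inner_normE : forall x : H, `|x| ^+ 2 = inner x x
}.

(* The inner product is linear in its first argument. *)
#[short(type="hilbertType")]
HB.structure Definition Hilbert (R : realType) :=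
  {H of CompleteNormedModule_isHilbert R H & CompleteNormedModule R[i] H}.

Section Operators.
Context {R : realType}.
Implicit Types X Y Z : normedModType R[i].

(* A partial operator; its values outside the domain are irrelevant. *)
Record partial_op X Y := PartialOp {
  dom : set X ;
  op_fun :> X -> Y
}.

Definition ran X Y (T : partial_op X Y) : set Y := T @` dom T.

Definition op_graph X Y (T : partial_op X Y) : set (X * Y) :=
  [set p | dom T p.1 /\ T p.1 = p.2].

Definition op_preimage X Y (T : partial_op X Y) (B : set Y) : set X :=
  dom T `&` T @^-1` B.

Definition op_comp X Y Z (S : partial_op Y Z) (T : partial_op X Y) :
    partial_op X Z :=
  PartialOp (op_preimage T (dom S)) (S \o T).

Definition linear_op X Y (T : partial_op X Y) : Prop :=
  submod_closed (mem (dom T)) /\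
  forall (a : R[i]) (x y : X), dom T x -> dom T y ->
    T (a *: x + y) = a *: T x + T y.

Definition closed_op X Y (T : partial_op X Y) : Prop := closed (op_graph T).

Definition graph_norm X Y (T : partial_op X Y) (x : X) : R[i] :=
  sqrtC (`|x| ^+ 2 + `|T x| ^+ 2).

Definition core X Y (T : partial_op X Y) (D : set X) : Prop :=
  [/\ D `<=` dom T, submod_closed (mem D) &
      forall x, dom T x -> forall e : R[i], 0 < e ->
        exists2 y, D y & graph_norm T (x - y) < e].

End Operators.

Section Duality.
Context {R : realType}.
Implicit Types X Y : normedModType R[i].

Definition antidual X : set (X -> R[i]) :=
  [set phi | (forall (a : R[i]) (x y : X),
               phi (a *: x + y) = a^* * phi x + phi y) /\
             continuous (phi : X -> R[i]^o)].

(* The real supremum is meaningful for continuous phi: the set is then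
   bounded, and it contains the value at 0. *)
Definition antidual_norm X (phi : X -> R[i]) : R :=
  sup [set complex.Re `|phi x| | x in [set x : X | `|x| <= 1]].

Definition isometric_bijective_to_antidual X Y (j : Y -> X -> R[i]) : Prop :=
  set_bij [set: Y] (antidual (X := X)) j /\
  forall y, (antidual_norm (j y))%:C = `|y|.

(* For b = <.,.>_{Y,X}, this is <.,.>_{X,Y}. *)
Definition flip_form X Y (b : Y -> X -> R[i]) : X -> Y -> R[i] :=
  fun x y => (b y x)^*.

Definition complete_dual_pair X Y
    (b : {bilinear Y -> X -> R[i] | *%R & Num.conj \; *%R}) : Prop :=
  [/\ continuous (fun p : Y * X => b p.1 p.2 : R[i]^o),
      isometric_bijective_to_antidual b &
      isometric_bijective_to_antidual (flip_form b)].

(* The adjoint of T : X1 -> X2 with respect to forms b1 on Y1 x X1 and b2 on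
   Y2 x X2: h is in the domain iff some g in Y1 satisfies
   b2 h (T f) = b1 g f for all f in dom T, and the adjoint maps h to g.
   Such a g is unique when T is densely defined and b1 is a dual pair. *)
Definition adjoint_graph X1 Y1 X2 Y2
    (b1 : Y1 -> X1 -> R[i]) (b2 : Y2 -> X2 -> R[i])
    (T : partial_op X1 X2) (h : Y2) : set Y1 :=
  [set g | forall f, dom T f -> b2 h (T f) = b1 g f].

Definition adjoint X1 Y1 X2 Y2
    (b1 : Y1 -> X1 -> R[i]) (b2 : Y2 -> X2 -> R[i])
    (T : partial_op X1 X2) : partial_op Y2 Y1 :=
  PartialOp [set h | adjoint_graph b1 b2 T h !=set0]
            (fun h => xget 0 (adjoint_graph b1 b2 T h)).

End Duality.

Section GelfandTriples.
Context {R : realType}.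

Record embedding (X : completeNormedModType R[i]) (X0 : hilbertType R)
    (iota : partial_op X X0) : Prop := {
  embedding_linear : linear_op iota ;
  embedding_densely_defined : dense (dom iota) ;
  embedding_closed : closed_op iota ;
  embedding_injective : set_inj (dom iota) iota ;
  embedding_dense_range : dense (ran iota)
}.

Record pre_quasi_gelfand_triple
    (Xp : completeNormedModType R[i]) (X0 : hilbertType R)
    (Xm : completeNormedModType R[i]) := {
  pairing : {bilinear Xm -> Xp -> R[i] | *%R & Num.conj \; *%R} ;
  iota_p : partial_op Xp X0 ;
  iota_m : partial_op Xm X0 ;
  pairing_complete : complete_dual_pair pairing ;
  iota_p_embedding : embedding iota_p ;
  iota_m_embedding : embedding iota_m ;
  pairingE : forall (f : Xp) (g : Xm), dom iota_p f -> dom iota_m g ->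
    pairing g f = inner (iota_m g) (iota_p f)
}.

Definition iota_p_adj Xp X0 Xm (G : pre_quasi_gelfand_triple Xp X0 Xm) :
    partial_op X0 Xm :=
  adjoint (pairing G) (inner : X0 -> X0 -> R[i]) (iota_p G).

Definition iota_m_adj Xp X0 Xm (G : pre_quasi_gelfand_triple Xp X0 Xm) :
    partial_op X0 Xp :=
  adjoint (flip_form (pairing G)) (inner : X0 -> X0 -> R[i]) (iota_m G).

Record quasi_gelfand_triple
    (Xp : completeNormedModType R[i]) (X0 : hilbertType R)
    (Xm : completeNormedModType R[i]) := {
  pre_triple :> pre_quasi_gelfand_triple Xp X0 Xm ;
  dom_iota_p_adj : dom (iota_p_adj pre_triple) = ran (iota_m pre_triple)
}.

Definition D_p Xp X0 Xm (G : pre_quasi_gelfand_triple Xp X0 Xm) : set X0 :=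
  ran (iota_p G).

Definition D_m Xp X0 Xm (G : pre_quasi_gelfand_triple Xp X0 Xm) : set X0 :=
  ran (iota_m G).

End GelfandTriples.

(* Main.v *)
Require Import Defs.
From HB Require Import structures.
From mathcomp Require Import all_boot all_order all_algebra.
From mathcomp Require Import sesquilinear complex ring.
From mathcomp Require Import all_classical all_reals all_analysis.

(* For a closed operator T between Hilbert spaces, two orthogonal projections
   in the product space give von Neumann's theorem that dom (T^* T) is a core
   of T: projecting (e, 0) on the graph of T yields v with v + T^* T v = e, and
   if e in dom T is graph-orthogonal to dom (T^* T), pairing it with v gives
   <e, e> = 0. Here iota_p^* is the inverse of iota_m by hypothesis, and
   iota_m^* is the inverse of iota_p because iota_p is closed, so that
   dom (iota_p^* iota_p) and dom (iota_m^* iota_m) are the preimages of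
   D_p `&` D_m. *)

Set Implicit Arguments.
Unset Strict Implicit.
Unset Printing Implicit Defensive.

Import Order.TTheory GRing.Theory Num.Theory.
Import numFieldNormedType.Exports.
Local Open Scope classical_set_scope.
Local Open Scope ring_scope.

(** * Inner product forms and approximate minimisers of the distance *)

Section DotForms.
Context {C : numClosedFieldType} {V : lmodType C} (f : {dot V for Num.conj}).
Implicit Types (r a x y : V).

Lemma dotC x y : f x y = (f y x)^*.
Proof. by rewrite hermC expr0 mul1r. Qed.

Lemma dotZl c x y : f (c *: x) y = c * f x y.
Proof. by rewrite linearZl_LR. Qed.

Lemma dotZr c x y : f x (c *: y) = c^* * f x y.
Proof. by rewrite linearZr_LR. Qed.

Lemma dot_ge0 x : 0 <= f x x.
Proof.
have [->|/neq0_dnorm_gt0/ltW//] := eqVneq x 0.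
by rewrite linear0l.
Qed.

Lemma dot_parallelogram x y :
  f (x + y) (x + y) + f (x - y) (x - y) = 2 * f x x + 2 * f y y.
Proof. by rewrite hnormD hnormB; ring. Qed.

Lemma dot_subZ x y c : f (x - c *: y) (x - c *: y) =
  f x x - c^* * f x y - c * (f x y)^* + c * c^* * f y y.
Proof.
rewrite linearBl/= !linearBr/= !dotZl !dotZr (dotC y x); ring.
Qed.

(* The scalar c = f r a / (1 + f a a) is tested in the hypothesis. *)
Lemma dot_almost_orthogonal r a (d : C) :
  (forall c, f r r <= f (r - c *: a) (r - c *: a) + d) ->
  `|f r a| ^+ 2 <= d * (1 + f a a).
Proof.
set b := f r a; set q := f a a => H.
have q0 : 0 <= q by exact: dot_ge0.
have q1 : 0 < 1 + q by rewrite (lt_le_trans ltr01)// lerDl.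
pose s := (1 + q)^-1.
have s0 : 0 < s by rewrite invr_gt0.
have /CrealP sR : s \is Num.real by rewrite ger0_real// ltW.
have := H (s * b).
rewrite dot_subZ -/b -/q rmorphM /= sR => {}H.
have nb : `|b| ^+ 2 = b * b^* by rewrite normCK.
have key : `|b| ^+ 2 * (2 - s * q) * s <= d.
  rewrite nb -subr_ge0.
  move: H; rewrite -subr_ge0; congr (_ <= _); ring.
(* Hence the factor [2 - s * q] in [key] is [1 + s], which is at least 1. *)
have e : s * q = 1 - s.
  have e1 : s * (1 + q) = 1 by rewrite mulVf ?lt0r_neq0.
  by rewrite -[in RHS]e1; ring.
have -> : `|b| ^+ 2 <= d * (1 + q) = (`|b| ^+ 2 * s <= d) by rewrite ler_pdivrMr.
apply: le_trans key; rewrite ler_wpM2r ?(ltW s0)//.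
rewrite -[leLHS]mulr1 ler_wpM2l ?exprn_ge0// e opprB addrCA -[X in _ <= _ + X]/(2 - 1).
by rewrite addrA; have -> : s + 2 - 1 = 1 + s; [ring|rewrite lerDl ltW].
Qed.

(** For [d = f x x] the hypothesis of [dot_almost_orthogonal] is just nonnegativity of [f]. The
    crude constant is enough for continuity of [inner]. *)
Lemma dot_weak_CauchySchwarz x y : `|f x y| ^+ 2 <= f x x * (1 + f y y).
Proof. by apply: dot_almost_orthogonal => c; rewrite lerDr dot_ge0. Qed.

(** Comparing with every [y] in [A] avoids naming an infimum, so the notion makes sense over any
    [numClosedFieldType]. *)
Definition almost_nearest (A : set V) z (d : C) x :=
  A x /\ forall y, A y -> f (z - x) (z - x) <= f (z - y) (z - y) + d.

(** Parallelogram law for [z - x] and [z - x']: the midpoint [m] lies in [A], so neither point is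
    closer to [z] than the allowed errors permit. *)
Lemma almost_nearest_close (A : set V) z d d' x x' :
  submod_closed (mem A) -> almost_nearest A z d x -> almost_nearest A z d' x' ->
  f (x - x') (x - x') <= 2 * d + 2 * d'.
Proof.
move=> [A0 AZ] [Ax Hx] [Ax' Hx'].
have Am : A (2^-1 *: x + 2^-1 *: x').
  apply/set_mem/AZ; last first.
    have := AZ 2^-1 x' 0; rewrite addr0; apply=> //; exact/mem_set.
  exact/mem_set.
have := dot_parallelogram (z - x) (z - x').
set m := 2^-1 *: x + _ in Am.
have -> : z - x + (z - x') = 2 *: (z - m).
  rewrite scalerBr scalerDr !scalerA mulfV ?pnatr_eq0// !scale1r.
  by rewrite scaler_nat mulr2n opprD addrACA.
have -> : z - x - (z - x') = - (x - x').
  by rewrite opprB opprB addrC addrA subrK addrC.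
rewrite hnormN dotZl dotZr /= conjC_nat => e.
rewrite -[leLHS](addKr (2 * (2 * f (z - m) (z - m)))) e -subr_ge0.
have -> : 2 * d + 2 * d' - (- (2 * (2 * f (z - m) (z - m))) +
    (2 * f (z - x) (z - x) + 2 * f (z - x') (z - x'))) =
    2 * (f (z - m) (z - m) + d - f (z - x) (z - x)) +
    2 * (f (z - m) (z - m) + d' - f (z - x') (z - x')) by ring.
by rewrite addr_ge0// mulr_ge0// subr_ge0; [exact: Hx|exact: Hx'].
Qed.

End DotForms.

(** * Orthogonal projection in a product of two Hilbert spaces *)

Section Projection.
Context {R : realType}.

(** The values [f (z - y) (z - y)] are real, so the infimum can be taken in [R] over their real
    parts. *)
Lemma almost_nearest_exists (V : lmodType R[i]) (f : {dot V for Num.conj})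
    (A : set V) z (d : R) : A !=set0 -> 0 < d ->
  exists x, almost_nearest f A z d%:C%C x.
Proof.
move=> [a Aa] d0.
pose S := [set complex.Re (f (z - y) (z - y)) | y in A].
have fR y : (complex.Re (f (z - y) (z - y)))%:C%C = f (z - y) (z - y).
  by rewrite RRe_real// ger0_real// dot_ge0.
have Sinf : has_inf S.
  split; first by exists (complex.Re (f (z - a) (z - a))), a.
  exists 0 => _ [y _ <-].
  by rewrite -lecR fR dot_ge0.
have [_ [x Ax <-]] := inf_adherent d0 Sinf.
move=> H; exists x; split=> // y Ay.
rewrite -(fR x) -(fR y) -rmorphD lecR (le_trans (ltW H))// lerD2r.
by apply: ge_inf; [exact: Sinf.2|exists y].
Qed.

Section PairDot.
Context {X Y : hilbertType R}.

(* The norm of X * Y is the maximum norm, which this form does not induce; it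
   only induces the topology of X * Y. *)
Definition pair_dot (p q : X * Y) : R[i] := inner p.1 q.1 + inner p.2 q.2.

Fact pair_dot_bilinear :
  bilinear_for (@GRing.mul R[i] : GRing.Scale.law _ _)
    (Num.conj \; *%R : GRing.Scale.law _ _) pair_dot.
Proof.
split=> u a x y; rewrite /pair_dot /= ?linearPl ?linearPr /=; ring.
Qed.

HB.instance Definition _ := bilinear_isBilinear.Build R[i] (X * Y)%type
  (X * Y)%type R[i] *%R (Num.conj \; *%R) pair_dot pair_dot_bilinear.

Fact pair_dot_hermitian (p q : X * Y) :
  pair_dot p q = (-1) ^+ false * Num.conj (pair_dot q p).
Proof. by rewrite expr0 mul1r /pair_dot rmorphD/= -!dotC. Qed.

HB.instance Definition _ := isHermitianSesquilinear.Build R[i] (X * Y)%type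
  false Num.conj pair_dot pair_dot_hermitian.

Fact pair_dot_gt0 (p : X * Y) : p != 0 -> 0 < pair_dot p p.
Proof.
case: p => x y; rewrite /pair_dot/=.
have [->|x0 _] := eqVneq x 0; last first.
  by rewrite ltr_wpDr ?dot_ge0 ?neq0_dnorm_gt0.
have [->|y0 _] := eqVneq y 0; first by rewrite eqxx.
by rewrite ltr_wpDl ?dot_ge0 ?neq0_dnorm_gt0.
Qed.

HB.instance Definition _ := isDotProduct.Build R[i] (X * Y)%type
  pair_dot pair_dot_gt0.

End PairDot.

Lemma additive_bounded_continuous (X : normedModType R[i]) (phi : X -> R[i]) K :
  (forall x y, phi (x - y) = phi x - phi y) ->
  0 < K -> (forall x, `|phi x| <= K * `|x|) ->
  continuous (phi : X -> R[i]^o).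
Proof.
move=> phiB K0 phiK x; apply/cvgrPdist_lt => e e0.
near=> y.
rewrite -phiB (le_lt_trans (phiK _))// mulrC -ltr_pdivlMr//.
near: y; apply: cvgr_dist_lt; first exact: cvg_id.
by rewrite divr_gt0.
Unshelve. all: by end_near. Qed.

Lemma inner_bounded (H : hilbertType R) (x y : H) :
  `|inner x y| <= (1 + inner y y) * `|x|.
Proof.
have y1 : 1 <= 1 + inner y y by rewrite lerDl dot_ge0.
have y0 : 0 <= 1 + inner y y by rewrite (le_trans ler01).
rewrite -(@ler_pXn2r _ 2)// ?nnegrE ?mulr_ge0//.
rewrite (le_trans (dot_weak_CauchySchwarz _ _ _))// exprMn inner_normE mulrC.
by rewrite ler_wpM2r ?dot_ge0// expr2 ler_peMr.
Qed.

Lemma inner_continuous (H : hilbertType R) (y : H) :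
  continuous (inner^~ y : H -> R[i]^o).
Proof.
apply: (@additive_bounded_continuous _ _ (1 + inner y y)).
- by move=> a b; rewrite linearBl.
- by rewrite (lt_le_trans ltr01)// lerDl dot_ge0.
- by move=> x; exact: inner_bounded.
Qed.

Lemma natSinv_lt (e : R[i]) : 0 < e ->
  \forall n \near \oo, (n.+1%:R^-1 : R)%:C%C < e.
Proof.
move=> e0; have er : (complex.Re e)%:C%C = e by rewrite RRe_real// gtr0_real.
have e1 : 0 < complex.Re e by rewrite -ltcR er.
near=> n; rewrite -er ltcR.
by near: n; exact: (near_infty_natSinv_lt (PosNum e1)).
Unshelve. all: by end_near. Qed.

Lemma harmonic_cauchy_cvg (Z : completeNormedModType R[i]) (v : nat -> Z) :
  (forall n m, `|v n - v m| ^+ 2 <=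
     2 * (n.+1%:R^-1 : R)%:C%C + 2 * (m.+1%:R^-1 : R)%:C%C) ->
  cvgn v.
Proof.
move=> Hv; apply/cauchy_cvgP/cauchy_exP => e e0.
(* Each of the two terms of the bound is then less than half of [e ^+ 2]. *)
have e4 : 0 < e ^+ 2 / 4 by rewrite divr_gt0// exprn_gt0.
have [N _ HN] := natSinv_lt e4.
exists (v N); exists N => // n Nn; rewrite /= -ball_normE/=.
rewrite -(@ltr_pXn2r _ 2)// ?nnegrE ?(ltW e0)//.
rewrite (le_lt_trans (Hv _ _))//.
have -> : e ^+ 2 = 2 * (e ^+ 2 / 4) + 2 * (e ^+ 2 / 4) by field.
by rewrite ltrD// ltr_pM2l//; apply: HN => /=.
Qed.

(** A minimising sequence with errors [1 / (n + 1)] is Cauchy in each component, because [pair_dot]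
    dominates the squared norm of each. Its limit stays in [A] by closedness, and orthogonality is
    inherited in the limit. *)
Lemma projection (X Y : hilbertType R) (A : set (X * Y)) (z : X * Y) :
  closed A -> submod_closed (mem A) ->
  exists2 p, A p & forall a, A a -> pair_dot (z - p) a = 0.
Proof.
move=> Acl Asub; have [A0 AZ] := Asub.
have A0' : A !=set0 by exists 0; exact/set_mem.
have /choice[u uA] n : exists x,
    almost_nearest pair_dot A z (n.+1%:R^-1 : R)%:C%C x.
  by apply: almost_nearest_exists => //; rewrite invr_gt0.
have uC n m := almost_nearest_close Asub (uA n) (uA m).
have u1 : cvgn (fst \o u).
  apply: harmonic_cauchy_cvg => n m; apply: le_trans (uC n m).
  by rewrite inner_normE /= /pair_dot lerDl dot_ge0.
have u2 : cvgn (snd \o u).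
  apply: harmonic_cauchy_cvg => n m; apply: le_trans (uC n m).
  by rewrite inner_normE /= /pair_dot lerDr dot_ge0.
pose p := (limn (fst \o u), limn (snd \o u)).
have up : u @ \oo --> p.
  have -> : u = (fun n => ((fst \o u) n, (snd \o u) n)).
    by apply/funext => n /=; case: (u n).
  exact: cvg_pair.
exists p.
  by apply: (closed_cvg A Acl _ p up); apply: nearW => n; exact: (uA n).1.
move=> a Aa; set l := pair_dot^~ a.
(* As [u n + c *: a] stays in [A], almost minimality of [u n] makes [z - u n] almost orthogonal to
   [a]. *)
have lo n : `|l (z - u n)| ^+ 2 <= (n.+1%:R^-1 : R)%:C%C * (1 + pair_dot a a).
  apply: dot_almost_orthogonal => c. have -> : z - u n - c *: a = z - (u n + c *: a) by rewrite opprD addrA.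
  have [Au] := uA n; apply.
  apply/set_mem; rewrite addrC; apply: AZ; exact/mem_set.
have lcvg : (fun n => l (z - u n) : R[i]^o) @ \oo --> (l (z - p) : R[i]^o).
  have c1 : (fun n => inner (z.1 - (u n).1) a.1 : R[i]^o) @ \oo -->
      (inner (z.1 - p.1) a.1 : R[i]^o).
    have h : (fun n => z.1 - (u n).1) @ \oo --> z.1 - p.1.
      by apply: cvgB; [exact: cvg_cst|exact: u1].
    exact: (cvg_comp _ _ h (@inner_continuous X a.1 _)).
  have c2 : (fun n => inner (z.2 - (u n).2) a.2 : R[i]^o) @ \oo -->
      (inner (z.2 - p.2) a.2 : R[i]^o).
    have h : (fun n => z.2 - (u n).2) @ \oo --> z.2 - p.2.
      by apply: cvgB; [exact: cvg_cst|exact: u2].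
    exact: (cvg_comp _ _ h (@inner_continuous Y a.2 _)).
  exact: (cvgD c1 c2).
apply: (cvg_unique _ lcvg) => //.
apply/cvgr0Pnorm_lt => e e0.
have a1 : 0 < 1 + pair_dot a a by rewrite (lt_le_trans ltr01)// lerDl dot_ge0.
near=> n.
rewrite -(@ltr_pXn2r _ 2)// ?nnegrE ?(ltW e0)//.
rewrite (le_lt_trans (lo n))// -ltr_pdivlMr//.
near: n; apply: natSinv_lt.
by rewrite divr_gt0 ?exprn_gt0.
Unshelve. all: by end_near. Qed.

End Projection.

(** * Subspaces, preimages and cores *)

Lemma submod_closedP (K : numFieldType) (V : lmodType K) (A : set V) :
  submod_closed (mem A) <->
  A 0 /\ forall a x y, A x -> A y -> A (a *: x + y).
Proof.
split=> [[A0 AZ]|[A0 AZ]]; split; first exact/set_mem.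
- by move=> a x y Ax Ay; apply/set_mem/AZ; exact/mem_set.
- exact/mem_set.
- by move=> a x y /set_mem Ax /set_mem Ay; apply/mem_set/AZ.
Qed.

Lemma submod_closed_closure (K : numFieldType) (V : normedModType K)
  (A : set V) : submod_closed (mem A) -> submod_closed (mem (closure A)).
Proof.
move=> /submod_closedP[A0 AZ]; apply/submod_closedP; split.
  exact: subset_closure.
move=> a x y Ax Ay B Bxy.
have : (fun p : V * V => a *: p.1 + p.2) @ (x, y) --> a *: x + y.
  by apply: cvgD; [apply: cvgZr; exact: cvg_fst|exact: cvg_snd].
move=> /(_ B Bxy)[[P Q] /= [Px Qy] PQB].
have [x' [Ax' Px']] := Ax _ Px.
have [y' [Ay' Qy']] := Ay _ Qy.
exists (a *: x' + y'); split; first exact: AZ.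
by apply: (PQB (x', y')).
Qed.

(** Reduces the two preimages of the intersection of [D_p G] and [D_m G] to preimages of [D_m G] and
    of [D_p G] alone. *)
Lemma op_preimage_ranI (R : realType) (X Y : normedModType R[i])
    (T : partial_op X Y) (B : set Y) :
  op_preimage T (ran T `&` B) = op_preimage T B.
Proof.
apply/seteqP; split=> [x [Dx []]|x [Dx Bx]]; first by [].
by split=> //; split=> //; exists x.
Qed.

Lemma core_sub (R : realType) (X Y : normedModType R[i]) (T : partial_op X Y)
    (D E : set X) : core T D -> D `<=` E -> E `<=` dom T ->
  submod_closed (mem E) -> core T E.
Proof.
move=> [_ _ DT] DE ET Esub; split=> // x Dx e e0.
by have [y Dy] := DT x Dx e e0; exists y => //; exact: DE.
Qed.

(** * Linear partial operators and density in the graph *)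

Section Operators.
Context {R : realType}.

Section LinearOp.
Context {X Y : normedModType R[i]} (T : partial_op X Y) (Tlin : linear_op T).

Lemma linear_op_dom0 : dom T 0.
Proof. by have [/submod_closedP[]] := Tlin. Qed.

Lemma linear_op_domP a x y : dom T x -> dom T y -> dom T (a *: x + y).
Proof. by have [/submod_closedP[_ H] _] := Tlin; exact: H. Qed.

Lemma linear_op_domB x y : dom T x -> dom T y -> dom T (x - y).
Proof. by move=> Dx Dy; rewrite addrC -scaleN1r; exact: linear_op_domP. Qed.

Lemma linear_opP a x y :
  dom T x -> dom T y -> T (a *: x + y) = a *: T x + T y.
Proof. by have [_] := Tlin; apply. Qed.

Lemma linear_opB x y : dom T x -> dom T y -> T (x - y) = T x - T y.
Proof.
by move=> Dx Dy; rewrite addrC -scaleN1r linear_opP// scaleN1r addrC.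
Qed.

Lemma linear_op0 : T 0 = 0.
Proof.
have D0 := linear_op_dom0.
by rewrite -[X in T X](subrr 0) linear_opB// subrr.
Qed.

Lemma submod_closed_ran : submod_closed (mem (ran T)).
Proof.
apply/submod_closedP; split.
  by exists 0; [exact: linear_op_dom0|exact: linear_op0].
move=> a _ _ [x Dx <-] [y Dy <-]; exists (a *: x + y).
  exact: linear_op_domP.
exact: linear_opP.
Qed.

Lemma submod_closed_op_preimage B :
  submod_closed (mem B) -> submod_closed (mem (op_preimage T B)).
Proof.
move=> /submod_closedP[B0 BZ]; apply/submod_closedP; split.
  by split; [exact: linear_op_dom0|rewrite /= linear_op0].
move=> a x y [Dx Bx] [Dy By]; split; first exact: linear_op_domP.
by rewrite /= linear_opP//; exact: BZ.
Qed.

(** The set in the conclusion is the graph of the restriction of [T] to [D]. *)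
Lemma submod_closed_restr_graph (D : set X) : submod_closed (mem D) ->
  D `<=` dom T -> submod_closed (mem (op_graph T `&` fst @^-1` D)).
Proof.
move=> /submod_closedP[D0 DZ] DT; apply/submod_closedP; split.
  by split=> //; split; [exact: DT|exact: linear_op0].
move=> a [x x'] [y y'] [[/= Dx <-] Dx'] [[/= Dy <-] Dy'].
split; last exact: DZ.
by split=> /=; [exact: linear_op_domP|exact: linear_opP].
Qed.

Lemma submod_closed_graph : submod_closed (mem (op_graph T)).
Proof.
have := submod_closed_restr_graph (proj1 Tlin) (@subset_refl _ _).
by congr (submod_closed (mem _)); apply/seteqP; split=> [p []//|p []].
Qed.

Lemma graph_norm_ge x : `|x| <= graph_norm T x.
Proof.
rewrite -(@sqrCK _ `|x|) ?normr_ge0// ler_sqrtC ?nnegrE ?addr_ge0 ?exprn_ge0//.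
by rewrite lerDl exprn_ge0.
Qed.

Lemma core_dense (D : set X) : core T D -> dense (dom T) -> dense D.
Proof.
move=> [_ _ TD] Tdense O O0 Oo.
have [x [Ox Dx]] := Tdense O O0 Oo.
have /nbhs_ballP[e /= e0 eO] := open_nbhs_nbhs (conj Oo Ox).
have [y Dy xy] := TD x Dx e e0.
exists y; split=> //; apply: eO; rewrite -ball_normE /=.
exact: le_lt_trans (graph_norm_ge _) xy.
Qed.

(** Passes from the product topology to the graph norm: if both components are within [e / 2], the
    squared graph norm is below [e ^+ 2 / 2]. *)
Lemma closure_graph_core (D : set X) : submod_closed (mem D) ->
  D `<=` dom T ->
  op_graph T `<=` closure (op_graph T `&` fst @^-1` D) -> core T D.
Proof.
move=> Dsub DT TD; split=> // x Dx e e0.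
have e2 : 0 < e / 2 by rewrite divr_gt0.
have [] := TD (x, T x) _ (ball (x, T x) (e / 2)) (nbhsx_ballx _ _ e2) => //.
move=> [y Ty] [[[/= Ty0 <-] Dy]] [/=]; rewrite -!ball_normE /= => b1 b2.
exists y => //.
rewrite /graph_norm linear_opB// -(@sqrCK _ e) ?(ltW e0)//.
rewrite ltr_sqrtC ?nnegrE ?addr_ge0 ?exprn_ge0 ?(ltW e0)//.
rewrite (@lt_trans _ _ ((e / 2) ^+ 2 + (e / 2) ^+ 2))//.
  by rewrite ltrD// ltr_pXn2r ?nnegrE ?(ltW e2).
rewrite -subr_gt0.
have -> : e ^+ 2 - ((e / 2) ^+ 2 + (e / 2) ^+ 2) = e ^+ 2 / 2 by field.
by rewrite divr_gt0// exprn_gt0.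
Qed.

End LinearOp.

(** * Von Neumann's core theorem *)

Section Hilbert.
Context {X Y : hilbertType R} (T : partial_op X Y).
Hypotheses (Tlin : linear_op T) (Tclosed : closed_op T).

(** This is the domain of [T^* T], with [v] as the value at [x]. It is stated through [inner] alone,
    so it does not depend on the pairing that represents the antidual of [X]. *)
Definition dom_normal : set X := [set x | dom T x /\
  exists v, forall f, dom T f -> inner (T x) (T f) = inner v f].

Lemma submod_closed_dom_normal : submod_closed (mem dom_normal).
Proof.
apply/submod_closedP; split.
  split; first exact: linear_op_dom0.
  by exists 0 => f _; rewrite linear_op0// !linear0l.
move=> a x y [Dx [v vE]] [Dy [w wE]]; split; first exact: linear_op_domP.
exists (a *: v + w) => f Df.
by rewrite linear_opP// !linearPl /= vE// wE.
Qed.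

(** The conclusion says that [y - T u] is in the domain of the Hilbert space adjoint [T^*], with
    value [u - x]. *)
Lemma op_graph_projection (x : X) (y : Y) : exists2 u, dom T u &
  forall f, dom T f -> inner (x - u) f + inner (y - T u) (T f) = 0.
Proof.
have [[u _] [/= Du <-] H] := projection (x, y) Tclosed (submod_closed_graph Tlin).
by exists u => // f Df; exact: (H (f, T f)).
Qed.

Lemma core_dom_normal : core T dom_normal.
Proof.
have Nsub := submod_closed_dom_normal.
have NT : dom_normal `<=` dom T by move=> x [].
apply: closure_graph_core => // -[x _] [/= Dx <-].
set B := _ `&` _.
(* Since [T] is closed, the projection of [(x, T x)] on [closure B] is again a point [(u, T u)] of
   the graph. *)
have BT : closure B `<=` op_graph T.
  by rewrite [X in _ `<=` X]((closure_id _).1 Tclosed); apply: closure_subset => p [].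
have [[u Tu] Bu H] := projection (x, T x) (@closed_closure _ _)
  (submod_closed_closure (submod_closed_restr_graph Tlin Nsub NT)).
have [/= Du uE] := BT _ Bu; rewrite -uE in Bu H.
have De : dom T (x - u) by exact: linear_op_domB.
suff xu : x - u = 0 by move/eqP: xu; rewrite subr_eq0 => /eqP ->.
set e := x - u in De *.
(* Solves [v + T^* T v = e], so [v] is in [dom_normal] and [(v, T v)] may be tested against the
   residual [(e, T e)]. *)
have [v Dv vE] := op_graph_projection e 0.
have {}vE f : dom T f -> inner (T v) (T f) = inner (e - v) f.
  move=> /vE/eqP; rewrite sub0r linearNl/= subr_eq0 => /eqP ->//.
have Nv : dom_normal v by split=> //; exists (e - v).
have := H (v, T v) (subset_closure (conj (conj Dv erefl) Nv)).
rewrite /pair_dot/= -linear_opB// -/e => ev.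
have := vE _ De; rewrite linearBl/= => ve.
apply/eqP; rewrite -normr_eq0 -sqrf_eq0 inner_normE.
have -> : inner e e = inner v e + inner (T v) (T e) by rewrite ve addrC subrK.
by rewrite [inner v e]dotC [inner (T v) _]dotC -rmorphD/= ev rmorph0.
Qed.

End Hilbert.
End Operators.

(** * Representing functionals by the antidual *)

Section Pairing.
Context {R : realType}.

Lemma inner_antidual (H : hilbertType R) (v : H) : antidual (inner v).
Proof.
split=> [a x y|]; first by rewrite linearPr.
apply: (@additive_bounded_continuous _ _ _ (1 + inner v v)).
- by move=> a b; rewrite linearBr.
- by rewrite (lt_le_trans ltr01)// lerDl dot_ge0.
- by move=> x; rewrite dotC norm_conjC inner_bounded.
Qed.

(** [inner v] belongs to the antidual, so surjectivity of [j] applies. This turns adjoint values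
    found through [inner] into elements of the paired space. *)
Lemma antidual_repr (H : hilbertType R) (Y : normedModType R[i])
    (j : Y -> H -> R[i]) : isometric_bijective_to_antidual j ->
  forall v, exists g, j g = inner v.
Proof.
move=> [[_ _ jsurj] _] v.
by have [g _ gv] := jsurj _ (inner_antidual v); exists g.
Qed.

(** The zero set of the continuous difference is closed; its complement, if nonempty, would meet
    [D]. *)
Lemma antidual_dense_eq (X Y : normedModType R[i]) (j : Y -> X -> R[i]) :
  isometric_bijective_to_antidual j -> forall (D : set X) g h, dense D ->
  (forall x, D x -> j g x = j h x) -> j g =1 j h.
Proof.
move=> [[jfun _ _] _] D g h Dd gh x.
have [[_ gc] [_ hc]] := (jfun g I, jfun h I).
pose k : X -> R[i]^o := fun x => j g x - j h x.
have kc : continuous k by move=> y; apply: cvgB; [exact: gc|exact: hc].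
apply/eqP; rewrite -subr_eq0; apply: contrapT => kx.
have Oo : open (~` (k @^-1` [set 0])).
  apply: closed_openC; apply: preimage_closed; first by move=> y _; exact: kc.
  exact: accessible_closed_set1 (hausdorff_accessible (@norm_hausdorff _ _)) _.
have [|y [ky Dy]] := Dd _ _ Oo.
  by exists x => /= k0; apply: kx; rewrite -[_ - _]/(k x) k0.
by apply: ky; rewrite /= /k gh// subrr.
Qed.

End Pairing.

(** * Domains of the adjoints in a quasi Gelfand triple *)

Section GelfandTriple.
Context {R : realType} {Xp X0 Xm : hilbertType R}.
Variable G : quasi_gelfand_triple Xp X0 Xm.

Lemma pairing_repr (v : Xp) : exists g, forall f, pairing G g f = inner v f.
Proof.
have [_ pX _] := pairing_complete G.
by have [g gE] := antidual_repr pX v; exists g => f; rewrite gE.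
Qed.

Lemma flip_pairing_repr (v : Xm) :
  exists f, forall g, flip_form (pairing G) f g = inner v g.
Proof.
have [_ _ pX] := pairing_complete G.
by have [f fE] := antidual_repr pX v; exists f => g; rewrite fE.
Qed.

(* This is iota_p^** = iota_p, since iota_p^* is the inverse of iota_m. *)
Lemma dom_iota_m_adj : dom (iota_m_adj G) = ran (iota_p G).
Proof.
have [Plin Pdense Pclosed _ _] := iota_p_embedding G.
apply/seteqP; split=> [y [x xE]|_ [x Dx <-]]; last first.
  exists x => g Dg; rewrite /flip_form pairingE//; exact: dotC.
(* The aim is that the residual [(x - u, y - v)] of projecting [(x, y)] on the graph of [iota_p]
   vanishes. *)
have [u Du uE] := op_graph_projection Plin Pclosed x y.
set v := iota_p G u in uE.
have [g gE] := pairing_repr (u - x).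
have gadj f : dom (iota_p G) f -> inner (y - v) (iota_p G f) = pairing G g f.
  move=> /uE/eqP; rewrite gE -(opprB u x) linearNl/= addrC subr_eq0.
  by move/eqP.
have : dom (iota_p_adj G) (y - v) by exists g.
rewrite dom_iota_p_adj => -[g' Dg' g'E].
have [_ pX _] := pairing_complete G.
(* The equality is needed at [x], which is not yet known to lie in [dom (iota_p G)]; hence the
   density argument. *)
have gg' : pairing G g =1 pairing G g'.
  by apply: (antidual_dense_eq pX Pdense) => f Df; rewrite -gadj// pairingE// g'E.
have yE : inner (y - v) y = inner (u - x) x.
  by rewrite -gE gg' [LHS]dotC -g'E xE// /flip_form; exact: conjCK.
have vE : inner (y - v) v = inner (u - x) u by rewrite -gE gadj.
(* Subtracting [vE] from [yE] gives minus the square of [u - x], so both squares vanish and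
   [y = iota_p G u]. *)
have : inner (y - v) (y - v) + inner (u - x) (u - x) = 0.
  by rewrite linearBr/= yE vE linearBr/= addrC addrA subrK subrr.
move/eqP; rewrite paddr_eq0 ?dot_ge0// -inner_normE sqrf_eq0 normr_eq0.
by rewrite subr_eq0 => /andP[/eqP -> _]; exists u.
Qed.

End GelfandTriple.

Theorem corollary5p1 (R : realType) (Xp X0 Xm : hilbertType R)
    (G : quasi_gelfand_triple Xp X0 Xm) :
  [/\ dom (op_comp (iota_p_adj G) (iota_p G))
        = op_preimage (iota_p G) (D_p G `&` D_m G)
      /\ dense (op_preimage (iota_p G) (D_p G `&` D_m G)),
      dom (op_comp (iota_m_adj G) (iota_m G))
        = op_preimage (iota_m G) (D_p G `&` D_m G)
      /\ dense (op_preimage (iota_m G) (D_p G `&` D_m G)),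
      core (iota_p G) (op_preimage (iota_p G) (D_p G `&` D_m G)) &
      core (iota_m G) (op_preimage (iota_m G) (D_p G `&` D_m G))].
Proof.
rewrite op_preimage_ranI [D_p G `&` _]setIC op_preimage_ranI.
have [Plin Pdense Pclosed _ _] := iota_p_embedding G.
have [Mlin Mdense Mclosed _ _] := iota_m_embedding G.
have cP : core (iota_p G) (op_preimage (iota_p G) (ran (iota_m G))).
  apply: core_sub (core_dom_normal Plin Pclosed) _ _ _.
  (* The vector [v] in [Xp] is replaced by the [g] in [Xm] inducing the same functional; [g] is then
     a value of [iota_p_adj G] at [iota_p G x]. *)
  - move=> x [Dx [v vE]]; split=> //; rewrite -dom_iota_p_adj.
    by have [g gE] := pairing_repr G v; exists g => f Df; rewrite gE vE.
  - by move=> x [].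
  - exact/submod_closed_op_preimage/submod_closed_ran.
have cM : core (iota_m G) (op_preimage (iota_m G) (ran (iota_p G))).
  apply: core_sub (core_dom_normal Mlin Mclosed) _ _ _.
  - move=> x [Dx [v vE]]; split=> //; rewrite -dom_iota_m_adj.
    by have [f fE] := flip_pairing_repr G v; exists f => g Dg; rewrite fE vE.
  - by move=> x [].
  - exact/submod_closed_op_preimage/submod_closed_ran.
split=> //; split.
- by rewrite /D_m -dom_iota_p_adj.
- exact: core_dense cP Pdense.
- by rewrite /D_p -dom_iota_m_adj.
- exact: core_dense cM Mdense.
Qed.
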